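(* Let $D\subset\mathbb{R}^d$ be a bounded and closed domain, let $f:D\to\mathbb{R}$ be continuous, and assume that $S=\{x\in D: f(x)=0\}$ is non-empty. Let $k>0$ and $C\in[\tfrac12,1]$. Let $(z_i)$ be a random sequence of points of $D$ generated by the following procedure: $z_0$ and $z_1$ are drawn uniformly in $D$, and $R_i=\|z_i-z_{i-1}\|$ for $i\ge 1$; for each $i\ge 1$, if $|f(z_i)|\le C\,|f(z_{i-1})|$, then $z_{i+1}:=z_i+u_i$, where $u_i$ is randomly drawn on the ball $\mathcal{B}\left(0,\frac{R_i}{2}+k|f(z_i)|\right)$; if this inequality is not fulfilled, the sequence stops (and $z_0$ and $z_1$ are drawn again to start a new sequence). Then any infinite sequence $(z_i)$ defined in this way converges almost surely, with limit in $S$.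
   Context: $\|\cdot\|$ denotes the norm on $\mathbb{R}^d$ (the absolute value when $d=1$), and $\mathcal{B}(\omega,r)$ is the ball with center $\omega$ and radius $r$. A sequence is infinite when it never stops, i.e. when $|f(z_i)|\le C|f(z_{i-1})|$ holds for all $i\ge 1$. *)

(* Defs.v *)
From HB Require Import structures.
From mathcomp Require Import all_boot all_order all_algebra.
From mathcomp Require Import all_classical all_reals all_analysis.

Set Implicit Arguments.
Unset Strict Implicit.
Unset Printing Implicit Defensive.

Import Order.TTheory GRing.Theory Num.Theory.
Import numFieldNormedType.Exports.

Local Open Scope classical_set_scope.
Local Open Scope ring_scope.

(* R^d is 'rV[R]_d. Its library topology comes from the sup norm, so it is the
   usual one; its sigma-algebra is generated by the coordinates, as for tuples
   in the library, which gives the Borel sets of R^d. *)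

Definition rV_display : measure_display.
Proof. exact: default_measure_display. Qed.

Section measurable_rV.
Variables (R : realType) (d : nat).

Let coord (j : 'I_d) (x : 'rV[R]_d) : R := x ord0 j.

Let rV_set0 : g_sigma_preimage coord set0.
Proof. exact: sigma_algebra0. Qed.

Let rV_setC A : g_sigma_preimage coord A -> g_sigma_preimage coord (~` A).
Proof. exact: sigma_algebraC. Qed.

Let rV_bigcup (F : (set 'rV[R]_d)^nat) :
  (forall i, g_sigma_preimage coord (F i)) ->
  g_sigma_preimage coord (\bigcup_i (F i)).
Proof. exact: sigma_algebra_bigcup. Qed.

HB.instance Definition _ := @isMeasurable.Build rV_display 'rV[R]_d
  (g_sigma_preimage coord) rV_set0 rV_setC rV_bigcup.

End measurable_rV.

(* d-dimensional Lebesgue measure, as the iterated product of the Lebesgue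
   measure of the line, carried to row vectors by (a, x) |-> (a, x_1, ..., x_d). *)
Fixpoint lebesgue_rV (R : realType) (d : nat) : set 'rV[R]_d -> \bar R :=
  match d with
  | 0%N => dirac (0 : 'rV[R]_0)
  | d'.+1 => pushforward (@lebesgue_measure R \x @lebesgue_rV R d')%E
      (fun p : R * 'rV[R]_d' => row_mx (p.1%:M : 'M[R]_1) p.2 : 'rV[R]_(1 + d'))
  end.

(* The library norm on 'rV[R]_d is the sup norm. *)
Definition enorm (R : realType) (d : nat) (x : 'rV[R]_d) : R :=
  Num.sqrt (\sum_(j < d) x ord0 j ^+ 2).

(* When E has Lebesgue measure 0 this is the zero function, so no random
   variable is uniform on such a set. *)
Definition uniform_law (R : realType) (d : nat) (E A : set 'rV[R]_d) : \bar R :=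
  (lebesgue_rV (E `&` A) * ((fine (lebesgue_rV E))^-1)%:E)%E.

(* The ball of radius 0 is the single point 0. *)
Definition ball_law (R : realType) (d : nat) (r : R) : set 'rV[R]_d -> \bar R :=
  if 0 < r then uniform_law [set u | enorm u <= r] else dirac (0 : 'rV[R]_d).

Section search.
Variables (R : realType) (d : nat) (D : set 'rV[R]_d) (f : 'rV[R]_d -> R).
Variables (k C : R).

(* f is only given on D: the test on x i presupposes that x i is in D, so a
   draw that leaves D stops the sequence. *)
Definition test_passed (x : nat -> 'rV[R]_d) (i : nat) : Prop :=
  D (x i) /\ `|f (x i)| <= C * `|f (x i.-1)|.

Definition running (x : nat -> 'rV[R]_d) (n : nat) : Prop :=
  D (x 0) /\ forall i, (1 <= i <= n)%N -> test_passed x i.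

Definition infinite_seq (x : nat -> 'rV[R]_d) : Prop :=
  D (x 0) /\ forall i, (1 <= i)%N -> test_passed x i.

Definition draw_radius (x : nat -> 'rV[R]_d) (i : nat) : R :=
  enorm (x i - x i.-1) / 2 + k * `|f (x i)|.

Definition history (T : Type) (z : nat -> T -> 'rV[R]_d) (i : nat) (w : T) :
    i.+1.-tuple 'rV[R]_d :=
  [tuple z j w | j < i.+1].

(* One run of the procedure. The last clause says that, given z_0, ..., z_i and
   on the event that the run has not stopped at rank i, the conditional law of
   u_i is uniform on the ball. The values of z after the run has stopped are
   arbitrary. *)
Record search_process (dT : measure_display) (T : measurableType dT)
    (P : probability T R) (z u : nat -> T -> 'rV[R]_d) : Prop := {
  measurable_point : forall i, measurable_fun setT (z i);
  measurable_draw : forall i, measurable_fun setT (u i);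
  initial_law : forall A B : set 'rV[R]_d, measurable A -> measurable B ->
    P (z 0 @^-1` A `&` z 1 @^-1` B) = (uniform_law D A * uniform_law D B)%E;
  step_eq : forall i w, (1 <= i)%N -> running (z ^~ w) i ->
    z i.+1 w = z i w + u i w;
  draw_law : forall i (H : set (i.+1.-tuple 'rV[R]_d)) (B : set 'rV[R]_d),
    (1 <= i)%N -> measurable H -> measurable B ->
    let E := history z i @^-1` H `&` [set w | running (z ^~ w) i] in
    P (E `&` u i @^-1` B) =
      (\int[P]_(w in E) ball_law (draw_radius (z ^~ w) i) B)%E
}.

End search.

(* Main.v *)
Require Import Defs.
From HB Require Import structures.
From mathcomp Require Import all_boot all_order all_algebra.
From mathcomp Require Import all_classical all_reals all_analysis.
From mathcomp Require Import measurable_realfun.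
From mathcomp Require Import ring lra.
Import Order.TTheory GRing.Theory Num.Theory.
Import numFieldNormedType.Exports.
Local Open Scope classical_set_scope.
Local Open Scope ring_scope.

(* While the run is alive, the draw [u i] is symmetric given the past, so each
   coordinate of [z] is a martingale; it stays bounded because [D] is bounded,
   up to one last draw of bounded radius. Hence the second moments of the draws
   made while the run is alive form a convergent series, and Kolmogorov's
   maximal inequality makes [z] a Cauchy sequence almost surely on the event
   that the run never stops. Moreover, when [|f (z i)| >= eta] the ball has
   radius at least [k eta], so the draw is large with probability at least 1/2;
   the second moments tending to 0, [|f (z i)| >= eta] for all [i] has
   probability 0. Since [|f (z i)|] is nonincreasing as [C <= 1], it tends to 0
   and the limit is a zero of [f]. The conditional expectations are expressed
   through integrals over events that depend on the past only. *)

Set Implicit Arguments.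
Unset Strict Implicit.
Unset Printing Implicit Defensive.

(** * Lebesgue measure on row vectors *)

Lemma measurable_coord (R : realType) (d : nat) (j : 'I_d) :
  measurable_fun setT (fun x : 'rV[R]_d => x ord0 j).
Proof.
move=> _ Y mY; rewrite setTI; apply: sub_sigma_algebra => /=.
rewrite -bigcup_seq/=; exists j => /=; first by rewrite mem_index_enum.
by exists Y => //; rewrite setTI.
Qed.

Lemma measurable_fun_rV dT (T : measurableType dT) (R : realType) (d : nat)
    (g : T -> 'rV[R]_d) :
  (forall j, measurable_fun setT (fun x => g x ord0 j)) ->
  measurable_fun setT g.
Proof.
move=> mg _ A mA.
suff : measurable `<=` [set B | measurable (g @^-1` B)] by rewrite setTI; apply.
apply: smallest_sub.
  split=> [|B mB|F mF] /=.
  - by rewrite preimage_set0.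
  - by rewrite setTD preimage_setC; exact: measurableC.
  - by rewrite preimage_bigcup; exact: bigcupT_measurable.
rewrite -bigcup_seq => B /= [j _ [C mC <-]] /=.
by rewrite setTI -[X in measurable X]setTI; exact: mg.
Qed.


Lemma measurable_ltset dT (T : measurableType dT) (R : realType)
    (g h : T -> R) :
  measurable_fun setT g -> measurable_fun setT h ->
  measurable [set x | g x < h x].
Proof.
move=> mg mh; have := measurable_fun_ltr mg mh measurableT (Y := [set true]).
by rewrite setTI; apply.
Qed.

Lemma measurable_leset dT (T : measurableType dT) (R : realType)
    (g h : T -> R) :
  measurable_fun setT g -> measurable_fun setT h ->
  measurable [set x | g x <= h x].
Proof.
move=> mg mh; have := measurable_fun_ler mg mh measurableT (Y := [set true]).
by rewrite setTI; apply.
Qed.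

Lemma measurable_forall_ord dT (T : measurableType dT) (d : nat)
    (A : 'I_d -> set T) :
  (forall j, measurable (A j)) -> measurable [set x | forall j, A j x].
Proof.
move=> mA; rewrite [X in measurable X](_ : _ = \big[setI/setT]_(j < d) A j).
  by apply: bigsetI_measurable => j _; exact: mA.
rewrite -bigcap_seq; apply/seteqP; split=> x /= Ax j; first by move=> _.
by apply: Ax; rewrite /= mem_index_enum.
Qed.

(** Boxes with rational centre and radius [n.+1%:R^-1] are countably many and measurable through the
    coordinates; an open set is the union of those it contains. *)
Lemma measurable_rV_open (R : realType) (d : nat) (U : set 'rV[R]_d) :
  open U -> measurable U.
Proof.
move=> oU.
pose box (q : 'rV[rat]_d * nat) : set 'rV[R]_d :=
  [set x | forall j, `|x ord0 j - ratr (q.1 ord0 j)| < q.2.+1%:R^-1].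
pose boxU q := if `[< box q `<=` U >] then box q else set0.
suff -> : U = \bigcup_q boxU q.
  apply: countable_bigcupT_measurable => [|q]; first exact: countableP.
  rewrite /boxU; case: asboolP => // _; apply: measurable_forall_ord => j.
  apply: measurable_ltset => //; apply: measurableT_comp => //.
  by apply: measurable_funB => //; exact: measurable_coord.
apply/seteqP; split=> x; last first.
  by move=> [q _]; rewrite /boxU; case: asboolP => // qU; exact: qU.
move=> Ux; have /nbhs_ballP[e /= e0 xeU] := open_nbhs_nbhs (conj oU Ux).
have /ltr_add_invr[n] : 0 < e / 2 by rewrite divr_gt0.
rewrite add0r => ne.
have rat_near j : {q : rat | `|x ord0 j - ratr q| < n.+1%:R^-1}.
  apply/cid; have [] := @rat_in_itvoo _ (x ord0 j) (x ord0 j + n.+1%:R^-1).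
    by rewrite ltrDl.
  move=> q; rewrite in_itv/= => /andP[xq qx]; exists q.
  by rewrite distrC ger0_norm ?subr_ge0 ?(ltW xq)// ltrBlDl.
exists (\row_j sval (rat_near j), n) => //.
rewrite /boxU; case: asboolP => [_ j|[]].
  by rewrite /= mxE; exact: svalP (rat_near j).
(* Both [x] and [y] are within [n.+1%:R^-1 < e / 2] of the rational centre. *)
move=> y qy; apply: xeU; split=> // i j; rewrite ord1 /ball/=.
move: (qy j); rewrite /= mxE; have /= := svalP (rat_near j).
move: (ratr _) => q xq yq.
have -> : x ord0 j - y ord0 j = (x ord0 j - q) - (y ord0 j - q) by ring.
rewrite (le_lt_trans (ler_normB _ _))// (lt_trans (ltrD xq yq))//.
by rewrite [e]splitr ltrD.
Qed.

Section sigma_finite_pushforward.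
Context d1 d2 (T1 : measurableType d1) (T2 : measurableType d2) (R : realType).
Variables (m : {measure set T1 -> \bar R}) (g : T1 -> T2).
Hypotheses (mg : measurable_fun setT g)
  (gm_fin : sigma_finite setT (pushforward m g)).

(* The proofs are arguments so that the structure can be inferred from them. *)
Definition sigma_finite_pushforward of measurable_fun setT g
  & sigma_finite setT (pushforward m g) := pushforward m g.

Let mu := sigma_finite_pushforward mg gm_fin.

HB.instance Definition _ := Measure.copy mu
  (measure_function_pushforward__canonical__measure_function_Measure m mg).
HB.instance Definition _ := Measure_isSigmaFinite.Build _ _ _ mu gm_fin.

End sigma_finite_pushforward.

Section lebesgue_rV.
Variable R : realType.

Let cons_rV d (p : measurableTypeR R * 'rV[R]_d) : 'rV[R]_d.+1 :=
  row_mx (p.1%:M : 'M[R]_1) p.2 : 'rV[R]_(1 + d).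

Let uncons_rV d (x : 'rV[R]_d.+1) : measurableTypeR R * 'rV[R]_d :=
  (x ord0 ord0, \row_j x ord0 (lift ord0 j)).

Let cons_rV0 d (p : measurableTypeR R * 'rV[R]_d) : cons_rV p ord0 ord0 = p.1.
Proof.
have -> : (ord0 : 'I_d.+1) = lshift d (ord0 : 'I_1) by exact/val_inj.
by rewrite [LHS](row_mxEl (p.1%:M : 'M[R]_1)) mxE.
Qed.

Let cons_rVS d (p : measurableTypeR R * 'rV[R]_d) j :
  cons_rV p ord0 (lift ord0 j) = p.2 ord0 j.
Proof.
have -> : lift ord0 j = rshift 1 j :> 'I_d.+1 by exact/val_inj.
by rewrite [LHS](row_mxEr (p.1%:M : 'M[R]_1)).
Qed.

Let measurable_cons_rV d : measurable_fun setT (@cons_rV d).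
Proof.
apply: measurable_fun_rV => j; case: (unliftP ord0 j) => [i ->|->].
  under eq_fun do rewrite cons_rVS.
  exact: (measurableT_comp (measurable_coord i) measurable_snd).
under eq_fun do rewrite cons_rV0.
exact: measurable_fst.
Qed.

Let measurable_uncons_rV d : measurable_fun setT (@uncons_rV d).
Proof.
apply: measurable_fun_pair; first exact: measurable_coord.
apply: measurable_fun_rV => j; under eq_fun do rewrite mxE.
exact: measurable_coord.
Qed.

Let cons_rVK d : cancel (@cons_rV d) (@uncons_rV d).
Proof.
move=> [a x]; rewrite /uncons_rV cons_rV0; congr pair.
by apply/rowP => j; rewrite mxE cons_rVS.
Qed.

Let lebesgue_rVS d : @lebesgue_rV R d.+1 =
  pushforward (@lebesgue_measure R \x @lebesgue_rV R d)%E (@cons_rV d).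
Proof. by []. Qed.

(** Sigma-finiteness goes through the induction with additivity, since the product with the line at
    the next dimension uses it. [lebesgue_rV] is a bare set function, so the structure is first
    obtained as a witness [m]. *)
Lemma lebesgue_rV_measure d :
  exists m : {sigma_finite_measure set 'rV[R]_d -> \bar R},
    m = @lebesgue_rV R d :> (set _ -> \bar R).
Proof.
elim: d => [|d [m mE]]; first by exists (dirac (0 : 'rV[R]_0)).
rewrite lebesgue_rVS -mE.
pose prod : {measure set _ -> \bar R} := (@lebesgue_measure R \x m)%E.
have mu_fin : sigma_finite setT (pushforward prod (@cons_rV d)).
  have /sigma_finiteP[F [F_cover F_nd F_fin]] :=
    sigma_finiteT (@lebesgue_measure R).
  have /sigma_finiteP[G [G_cover G_nd G_fin]] := sigma_finiteT m.
  (* Rectangles of finite measure, pulled back along [uncons_rV]. Both covers are nondecreasing, so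
     a point caught at ranks [a] and [b] is caught in both factors at [maxn a b]. *)
  exists (fun n => @uncons_rV d @^-1` (F n `*` G n)).
    apply/seteqP; split=> // x _.
    have [a _ Fa] : (\bigcup_n F n) (uncons_rV x).1 by rewrite -F_cover.
    have [b _ Gb] : (\bigcup_n G n) (uncons_rV x).2 by rewrite -G_cover.
    exists (maxn a b) => //; split.
      by have /subsetPset := F_nd _ _ (leq_maxl a b); exact.
    by have /subsetPset := G_nd _ _ (leq_maxr a b); exact.
  move=> n; have [mF Foo] := F_fin n; have [mG Goo] := G_fin n; split.
    rewrite -[X in measurable X]setTI; apply: measurable_uncons_rV => //.
    exact: measurableX.
  rewrite /= /pushforward -comp_preimage.
  rewrite (_ : _ \o _ = id) ?preimage_id; last exact/funext/cons_rVK.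
  by rewrite product_measure1E// lte_mul_pinfty// ge0_fin_numE.
by exists (sigma_finite_pushforward (@measurable_cons_rV d) mu_fin).
Qed.

Let lebesgue_rV0 d : @lebesgue_rV R d set0 = 0%E.
Proof. by have [m <-] := lebesgue_rV_measure d; exact: measure0. Qed.

Let lebesgue_rV_ge0 d A : (0 <= @lebesgue_rV R d A)%E.
Proof. by have [m <-] := lebesgue_rV_measure d; exact: measure_ge0. Qed.

Let lebesgue_rV_sigma_additive d : semi_sigma_additive (@lebesgue_rV R d).
Proof.
have [m <-] := lebesgue_rV_measure d.
exact: (@measure_semi_sigma_additive _ _ _ m).
Qed.

HB.instance Definition _ d := isMeasure.Build _ _ _ (@lebesgue_rV R d)
  (lebesgue_rV0 d) (@lebesgue_rV_ge0 d) (@lebesgue_rV_sigma_additive d).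

Let lebesgue_rV_sigma_finite d : sigma_finite setT (@lebesgue_rV R d).
Proof. have [m <-] := lebesgue_rV_measure d; exact: (sigma_finiteT m). Qed.

HB.instance Definition _ d := Measure_isSigmaFinite.Build _ _ _
  (@lebesgue_rV R d) (@lebesgue_rV_sigma_finite d).

Lemma measurable_rVN d : measurable_fun setT (-%R : 'rV[R]_d -> 'rV[R]_d).
Proof.
apply: measurable_fun_rV => j; under eq_fun do rewrite mxE.
exact: measurableT_comp (measurable_coord j).
Qed.

(** Negation reflects the first coordinate and each section: the sections are handled by induction,
    the first coordinate by the reflection invariance of Lebesgue measure on the line. *)
Lemma lebesgue_rVN d (A : set 'rV[R]_d) : measurable A ->
  lebesgue_rV (-%R @^-1` A) = lebesgue_rV A.
Proof.
elim: d A => [|d IHd] A mA.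
  congr lebesgue_rV; apply/seteqP; split=> x.
    by rewrite /= (_ : - x = x)//; apply/rowP => -[].
  by rewrite /= (_ : - x = x)//; apply/rowP => -[].
rewrite lebesgue_rVS /pushforward /product_measure1.
have mB : measurable (@cons_rV d @^-1` A).
  by rewrite -[X in measurable X]setTI; exact: measurable_cons_rV.
set B := cons_rV (d := d) @^-1` A in mB *.
have mLB := measurable_fun_xsection (@lebesgue_rV R d) mB.
transitivity (\int[@lebesgue_measure R]_x
    ((@lebesgue_rV R d \o xsection B) \o -%R) x)%E.
  apply: eq_integral => x _ /=.
  rewrite -(IHd (xsection B (- x))); last exact: measurable_xsection.
  congr lebesgue_rV; apply/seteqP.
  have consN y : - cons_rV (x, y) = cons_rV (- x, - y).
    apply/rowP => j; rewrite mxE; case: (unliftP ord0 j) => [i ->|->].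
      by rewrite !cons_rVS mxE.
    by rewrite !cons_rV0.
  by split=> y; rewrite /xsection /B /= !inE/= consN.
have mN : measurable_fun setT (-%R : measurableTypeR R -> measurableTypeR R).
  exact: oppr_measurable.
have := ge0_integral_pushforward mN (@lebesgue_measure R) measurableT mLB.
move=> <-; last by move=> y _; exact: measure_ge0.
by apply: eq_measure_integral => C mC _; exact: lebesgue_measureN.
Qed.

Lemma lebesgue_rV_cube d (a : R) : 0 <= a ->
  @lebesgue_rV R d [set x | forall j, `|x ord0 j| <= a] = ((2 * a) ^+ d)%:E.
Proof.
move=> a0; elim: d => [|d IHd].
  by rewrite /lebesgue_rV/= diracE mem_set ?expr0// => -[].
rewrite lebesgue_rVS /pushforward.
rewrite (_ : _ @^-1` _ = `[- a, a]%classic `*`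
    [set x : 'rV[R]_d | forall j, `|x ord0 j| <= a]).
  rewrite product_measure1E//.
    rewrite [X in (_ * X)%E]IHd [X in (X * _)%E]lebesgue_measure_itv/= lte_fin.
    (* The length formula for an interval tests whether the endpoints are strictly ordered, so the
       degenerate cube is treated apart. *)
    have [->|a_neq0] := eqVneq a 0.
      by rewrite oppr0 ltxx mul0e exprS mulr0 mul0r.
    rewrite ifT; last by rewrite gtrN// lt_neqAle eq_sym a_neq0.
    by rewrite -EFinD -EFinM exprS opprK mulr_natl mulr2n.
  apply: measurable_forall_ord => j; apply: measurable_leset => //.
  by apply: measurableT_comp => //; exact: measurable_coord.
apply/seteqP; split=> -[b x] /=.
  move=> bxa; split=> [|j].
    by rewrite in_itv/= -ler_norml; have := bxa ord0; rewrite cons_rV0.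
  by have := bxa (lift ord0 j); rewrite cons_rVS.
rewrite in_itv/= -ler_norml => -[ba xa] j.
by case: (unliftP ord0 j) => [i ->|->]; rewrite ?cons_rVS ?cons_rV0.
Qed.

End lebesgue_rV.

(** * Uniform draws in a ball *)

Section ball_law.
Variables (R : realType) (d : nat).
Implicit Types (x u : 'rV[R]_d) (r a : R).

Lemma normr_le_enorm x j : `|x ord0 j| <= enorm x.
Proof.
rewrite /enorm -sqrtr_sqr ler_wsqrtr// (bigD1 j)//= lerDl.
by apply: sumr_ge0 => i _; exact: sqr_ge0.
Qed.

Lemma enorm_le_cube x a : 0 <= a -> (forall j, `|x ord0 j| <= a) ->
  enorm x <= d%:R * a.
Proof.
move=> a0 xa; rewrite -(ger0_norm (mulr_ge0 (ler0n R d) a0)) -sqrtr_sqr.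
rewrite /enorm ler_wsqrtr// (@le_trans _ _ (\sum_(j < d) a ^+ 2))//.
  apply: ler_sum => j _; rewrite -real_normK ?num_real//.
  by rewrite lerXn2r ?nnegrE.
rewrite sumr_const card_ord exprMn -[leLHS]mulr_natl ler_wpM2r ?sqr_ge0//.
by rewrite -natrX ler_nat; case: (d) => // n; rewrite leq_pmulr.
Qed.

Lemma enorm_opp u : enorm (- u) = enorm u.
Proof.
by rewrite /enorm; congr Num.sqrt; apply: eq_bigr => j _; rewrite mxE sqrrN.
Qed.

Lemma measurable_enorm_ball r : measurable [set u : 'rV[R]_d | enorm u <= r].
Proof.
apply: measurable_leset => //; rewrite /enorm.
have msqrt : measurable_fun setT (@Num.sqrt R).
  by apply: continuous_measurable_fun; exact: sqrt_continuous.
apply: (measurableT_comp msqrt).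
apply: measurable_sum => j; apply: measurable_funX; exact: measurable_coord.
Qed.

(** The ball and Lebesgue measure are both invariant under negation, and so is the point mass at 0.
    This is the source of the martingale property. *)
Lemma ball_lawN r (B : set 'rV[R]_d) : measurable B ->
  ball_law r (-%R @^-1` B) = ball_law r B.
Proof.
move=> mB; rewrite /ball_law; case: ifP => _.
  rewrite /uniform_law; congr (_ * _)%E.
  rewrite -[RHS]lebesgue_rVN; last first.
    exact: measurableI (measurable_enorm_ball r) _.
  by congr lebesgue_rV; apply/seteqP; split=> u /=; rewrite enorm_opp.
rewrite !diracE; congr (_%:R%:E); congr (nat_of_bool _).
by apply/idP/idP; rewrite !inE/= oppr0.
Qed.

Lemma ball_law_ge0 r (B : set 'rV[R]_d) : (0 <= ball_law r B)%E.
Proof.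
rewrite /ball_law; case: ifP => _; last by rewrite diracE lee_fin.
rewrite /uniform_law mule_ge0// lee_fin invr_ge0 fine_ge0//.
Qed.

Lemma ball_law_outside r a (j : 'I_d) : 0 <= a -> r <= a ->
  ball_law r [set u : 'rV[R]_d | a < `|u ord0 j|] = 0%E.
Proof.
move=> a0 ra; rewrite /ball_law; case: ifP => _.
  rewrite /uniform_law (_ : _ `&` _ = set0) ?measure0 ?mul0e//.
  apply/seteqP; split=> // u [/= ur] /(lt_le_trans)/(_ (normr_le_enorm u j)).
  by move=> /lt_le_trans/(_ ur) /lt_le_trans/(_ ra); rewrite ltxx.
by rewrite diracE memNset//= mxE normr0 => /lt_le_trans/(_ a0); rewrite ltxx.
Qed.

Lemma lebesgue_rV_enorm_ball_lb r : (0 < d)%N -> 0 < r ->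
  (((2 * (r / d%:R)) ^+ d)%:E <=
   lebesgue_rV [set u : 'rV[R]_d | (enorm u <= r)%R])%E.
Proof.
move=> d0 r0; rewrite -lebesgue_rV_cube ?divr_ge0 ?(ltW r0)//.
apply: le_measure; rewrite ?inE.
- apply: measurable_forall_ord => j; apply: measurable_leset => //.
  by apply: measurableT_comp => //; exact: measurable_coord.
- exact: measurable_enorm_ball.
move=> u /= /enorm_le_cube; rewrite divr_ge0 ?(ltW r0)// => /(_ isT).
by rewrite mulrC divfK// pnatr_eq0 -lt0n.
Qed.

(** The ball sits in the cube of half-side [r]. Finiteness matters because [fine] sends an infinite
    mass to 0, which would make [uniform_law] vanish. *)
Lemma lebesgue_rV_enorm_ball_fin r : 0 <= r ->
  (lebesgue_rV [set u : 'rV[R]_d | (enorm u <= r)%R] < +oo)%E.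
Proof.
move=> r0; apply: (@le_lt_trans _ _ ((2 * r) ^+ d)%:E); last exact: ltry.
rewrite -lebesgue_rV_cube//; apply: le_measure; rewrite ?inE.
- exact: measurable_enorm_ball.
- apply: measurable_forall_ord => j; apply: measurable_leset => //.
  by apply: measurableT_comp => //; exact: measurable_coord.
by move=> u /= ur j; exact: le_trans (normr_le_enorm u j) ur.
Qed.

(** The ball contains the cube of half-side [r / d%:R >= 2 * a], whose volume is [2 ^+ d] times that
    of the cube of half-side [a]; as [d] is positive, this factor is at least 2. *)
Lemma ball_law_cube r a : (0 < d)%N -> 0 < a -> 2 * d%:R * a <= r ->
  (ball_law r [set u : 'rV[R]_d | forall j, (`|u ord0 j| <= a)%R] <=
   (2^-1)%:E)%E.
Proof.
move=> d0 a0 ar.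
have d_gt0 : 0 < d%:R :> R by rewrite ltr0n.
have r0 : 0 < r by apply: lt_le_trans ar; rewrite !mulr_gt0.
rewrite /ball_law r0 /uniform_law.
set B := [set u | enorm u <= r]; set K := [set u : 'rV_d | _].
have mK : measurable K.
  apply: measurable_forall_ord => j; apply: measurable_leset => //.
  by apply: measurableT_comp => //; exact: measurable_coord.
have LBK : (lebesgue_rV (B `&` K) <= ((2 * a) ^+ d)%:E)%E.
  rewrite -lebesgue_rV_cube ?(ltW a0)//; apply: le_measure; rewrite ?inE//.
  exact: measurableI (measurable_enorm_ball r) mK.
have LB : (((2 * (2 * a)) ^+ d)%:E <= lebesgue_rV B)%E.
  apply: le_trans (lebesgue_rV_enorm_ball_lb d0 r0); rewrite lee_fin.
  have ar' : 2 * a <= r / d%:R by rewrite ler_pdivlMr// mulrAC.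
  have a2 : 0 <= 2 * a by rewrite mulr_ge0 ?(ltW a0).
  have a2' : 2 * (2 * a) <= 2 * (r / d%:R) by rewrite ler_wpM2l.
  by rewrite lerXn2r// nnegrE mulr_ge0// (le_trans a2).
have LB_fin : lebesgue_rV B \is a fin_num.
  by rewrite ge0_fin_numE ?measure_ge0// lebesgue_rV_enorm_ball_fin// ltW.
rewrite -(fineK LB_fin) lee_fin in LB.
have a_gt0 : 0 < (2 * a) ^+ d by rewrite exprn_gt0// mulr_gt0.
have LB_gt0 : 0 < fine (lebesgue_rV B).
  by apply: lt_le_trans LB; rewrite exprMn mulr_gt0// exprn_gt0.
apply: (@le_trans _ _ (((2 * a) ^+ d)%:E * ((fine (lebesgue_rV B))^-1)%:E)%E).
  by rewrite lee_wpmul2r// lee_fin invr_ge0 ltW.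
rewrite -EFinM lee_fin ler_pdivrMr// [leRHS]mulrC ler_pdivlMr//.
apply: le_trans LB; rewrite [leRHS]exprMn mulrC ler_wpM2r ?(ltW a_gt0)//.
by rewrite -[leLHS]expr1 ler_eXn2l// ltr1n.
Qed.

End ball_law.

(** * Comparison of nonnegative integrals *)

Section integrals.
Context dT (T : measurableType dT) (R : realType).

(** The integrand of [draw_law] comes with no measurability statement. Monotonicity holds
    regardless, a nonnegative integral being the supremum over the simple functions below the
    integrand. *)
Lemma ge0_le_integral_nonmeasurable (P : {measure set T -> \bar R})
    (E : set T) (g h : T -> \bar R) :
  (forall x, E x -> (0 <= g x)%E) -> (forall x, E x -> (g x <= h x)%E) ->
  (\int[P]_(x in E) g x <= \int[P]_(x in E) h x)%E.
Proof.
move=> g0 gh; have h0 x : E x -> (0 <= h x)%E.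
  by move=> Ex; rewrite (le_trans (g0 x Ex))// gh.
rewrite !ge0_integralE//; apply: le_ereal_sup => _ [s sg <-]; exists s => //= x.
apply: le_trans (sg x) _; rewrite /patch; case: ifPn => //; rewrite inE.
exact: gh.
Qed.

(** The laws of [(y, u)] and [(y, v)] under [P] restricted to [E] are finite measures that agree on
    rectangles, a generating class stable under intersection; hence they are equal. *)
Lemma eq_law_integral (P : probability T R) (E : set T) (y u v : T -> R)
    (g : R * R -> \bar R) :
  measurable E -> measurable_fun setT y -> measurable_fun setT u ->
  measurable_fun setT v -> measurable_fun setT g -> (forall p, (0 <= g p)%E) ->
  (forall A B : set R, measurable A -> measurable B ->
    P (E `&` (y @^-1` A `&` u @^-1` B)) =
    P (E `&` (y @^-1` A `&` v @^-1` B))) ->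
  (\int[P]_(x in E) g (y x, u x) = \int[P]_(x in E) g (y x, v x))%E.
Proof.
move=> mE my mu mv mg g0 uv.
have restr (w : T -> R) : measurable_fun setT w ->
    (\int[P]_(x in E) g (y x, w x) =
     \int[pushforward (mrestr P mE) (fun x => (y x, w x))]_p g p)%E.
  move=> mw; have myw := measurable_fun_pair my mw.
  rewrite ge0_integral_pushforward//=.
  rewrite [RHS](@ge0_negligible_integral _ _ _ _ _ (~` E))//=.
  - rewrite setTD setCK; apply: eq_measure_integral => A mA AE.
    by rewrite /= /mrestr setIidl.
  - exact: measurableC.
  - by rewrite preimage_setT.
  - by rewrite preimage_setT; exact: (measurableT_comp mg myw).
  - by rewrite /= /mrestr setICl measure0.
rewrite !restr//; pose yu x := (y x, u x); pose yv x := (y x, v x).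
have myu : measurable_fun setT yu := measurable_fun_pair my mu.
have myv : measurable_fun setT yv := measurable_fun_pair my mv.
pose G : set (set (R * R)) :=
  [set C | exists2 A, measurable A & exists2 B, measurable B & C = A `*` B].
apply: eq_measure_integral => C mC _.
pose m1 : {measure set (R * R)%type -> \bar R} :=
  measure_function_pushforward__canonical__measure_function_Measure
    (mrestr P mE) myu.
pose m2 : {measure set (R * R)%type -> \bar R} :=
  measure_function_pushforward__canonical__measure_function_Measure
    (mrestr P mE) myv.
have GI : setI_closed G.
  move=> _ _ [A mA [B mB ->]] [A' mA' [B' mB' ->]].
  exists (A `&` A'); first exact: measurableI.
  by exists (B `&` B'); [exact: measurableI|rewrite setXI].
apply: (measure_unique G (fun=> setT) _ GI _ _ m1 m2) => //=.
- rewrite measurable_prod_measurableType; congr (<<s _ >>).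
  apply/seteqP; split=> [_ [A mA [B mB <-]]|_ [A mA [B mB ->]]].
    by exists A => //; exists B.
  by exists A => //; exists B.
- by move=> _; exists setT => //; exists setT => //; rewrite setXTT.
- by rewrite bigcup_const.
- move=> _ [A mA [B mB ->]]; rewrite /pushforward /mrestr !(setIC _ E).
  exact: uv.
- move=> _; rewrite /pushforward /mrestr -ge0_fin_numE// fin_num_measure//.
  by rewrite preimage_setT setTI.
Qed.

End integrals.

(** * Events of the past *)

Section adapted.
Context dT (T : measurableType dT) (R : realType) (d : nat).
Variables (z : nat -> T -> 'rV[R]_d) (n : nat).

(** Membership in the sigma-algebra generated by [z 0, ..., z n], written as a preimage under
    [history] to match the events of [draw_law]. *)
Definition adapted (E : set T) : Prop :=
  exists2 H : set (n.+1.-tuple 'rV[R]_d),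
    measurable H & E = history z n @^-1` H.

Definition adapted_fun (y : T -> R) : Prop :=
  exists2 g : n.+1.-tuple 'rV[R]_d -> R,
    measurable_fun setT g & y = g \o history z n.

Lemma adaptedT : adapted setT.
Proof. by exists setT => //; rewrite preimage_setT. Qed.

Lemma adaptedI E F : adapted E -> adapted F -> adapted (E `&` F).
Proof.
by move=> [H mH ->] [K mK ->]; exists (H `&` K); first exact: measurableI.
Qed.

Lemma adapted_forall (E : nat -> set T) :
  (forall i, adapted (E i)) -> adapted [set w | forall i, E i w].
Proof.
move=> /(_ _)/cid2-/all_sig[H /all_and2[mH EH]].
exists (\bigcap_i H i); first exact: bigcapT_measurable.
apply/seteqP; split=> w Hw i; first by move=> _; have := Hw i; rewrite EH.
by rewrite EH; exact: Hw.
Qed.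

(** Turns a quantification over a range of ranks into one over all ranks, as in [adapted_forall]:
    outside the range the event is everything. *)
Lemma adapted_imply (b : bool) E : (b -> adapted E) ->
  adapted [set w | b -> E w].
Proof.
case: b => [/(_ isT)|_]; last first.
  by rewrite (_ : mkset _ = setT); [exact: adaptedT|apply/seteqP; split].
by rewrite (_ : mkset _ = E)//; apply/seteqP; split=> w //=; exact.
Qed.

Lemma adapted_preimage y B : adapted_fun y -> measurable B ->
  adapted (y @^-1` B).
Proof.
move=> [g mg ->] mB; exists (g @^-1` B) => //.
by rewrite -[X in measurable X]setTI; exact: mg.
Qed.

Lemma adapted_le y1 y2 : adapted_fun y1 -> adapted_fun y2 ->
  adapted [set w | y1 w <= y2 w].
Proof.
by move=> [g mg ->] [h mh ->]; exists [set t | g t <= h t];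
  first exact: measurable_leset.
Qed.

Lemma adapted_lt y1 y2 : adapted_fun y1 -> adapted_fun y2 ->
  adapted [set w | y1 w < y2 w].
Proof.
by move=> [g mg ->] [h mh ->]; exists [set t | g t < h t];
  first exact: measurable_ltset.
Qed.

Lemma adapted_fun_cst (a : R) : adapted_fun (cst a).
Proof. by exists (cst a). Qed.

Lemma adapted_fun_comp (h : R -> R) y : measurable_fun setT h ->
  adapted_fun y -> adapted_fun (h \o y).
Proof.
by move=> mh [g mg ->]; exists (h \o g) => //; exact: (measurableT_comp mh mg).
Qed.

Lemma adapted_funB y1 y2 : adapted_fun y1 -> adapted_fun y2 ->
  adapted_fun (fun w => y1 w - y2 w).
Proof.
by move=> [g mg ->] [h mh ->]; exists (fun t => g t - h t);
  first exact: measurable_funB.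
Qed.

Lemma adapted_fun_point (h : 'rV[R]_d -> R) i : measurable_fun setT h ->
  (i <= n)%N -> adapted_fun (fun w => h (z i w)).
Proof.
move=> mh; rewrite -ltnS => lin; exists (fun t => h (tnth t (Ordinal lin))).
  exact: (measurableT_comp mh (measurable_tnth (Ordinal lin))).
by apply/funext => w /=; rewrite tnth_mktuple.
Qed.

Hypothesis mz : forall i, measurable_fun setT (z i).

Lemma measurable_history : measurable_fun setT (history z n).
Proof.
apply/measurable_fun_tnthP => i.
by rewrite (_ : _ \o _ = z i)//; apply/funext => w /=; rewrite tnth_mktuple.
Qed.

Lemma adapted_measurable E : adapted E -> measurable E.
Proof.
move=> [H mH ->]; rewrite -[X in measurable X]setTI.
exact: measurable_history.
Qed.

Lemma adapted_fun_measurable y : adapted_fun y -> measurable_fun setT y.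
Proof.
by move=> [g mg ->]; exact: (measurableT_comp mg measurable_history).
Qed.

End adapted.

Lemma measurable_within_continuous (R : realType) (d : nat) (D : set 'rV[R]_d)
    (f : 'rV[R]_d -> R) :
  measurable D -> {within D, continuous f} -> measurable_fun D f.
Proof.
move=> mD /continuousP fc; apply: (measurability _ (RGenOpens.measurableE R)).
move=> _ [_ [a [b ->] <-]].
have : open (f @^-1` `]a, b[ : set (subspace D)) by exact/fc/interval_open.
move=> /open_subspaceP[V oV]; rewrite setIC [RHS]setIC => <-.
by apply: measurableI => //; exact: measurable_rV_open.
Qed.

(** * The search process *)

Section process.
Context dT (T : measurableType dT) (R : realType) (d : nat).
Variables (D : set 'rV[R]_d) (f : 'rV[R]_d -> R) (k C : R).
Variables (P : probability T R) (z u : nat -> T -> 'rV[R]_d).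
Hypotheses (mD : measurable D) (mf : measurable_fun D f).
Hypothesis z_process : search_process D f k C P z u.

Let alive n := [set w | running D f C (z ^~ w) n].

Let mz := measurable_point z_process.
Let mu := measurable_draw z_process.

(** [f] is measurable on [D] only; its extension by 0 is measurable everywhere and agrees with [f]
    along a running sequence. *)
Let fD := f \_ D.

Let mfD : measurable_fun setT fD.
Proof. exact/(measurable_restrictT _ mD). Qed.

Lemma aliveS n : alive n.+1 `<=` alive n.
Proof.
move=> w [Dw Hw]; split=> // i /andP[i1 lin].
by apply: Hw; rewrite i1 (leq_trans lin).
Qed.

Lemma alive_point n i : (i <= n)%N -> alive n `<=` [set w | D (z i w)].
Proof.
case: i => [_ w []//|i lin w [_ Hw]]; exact: (Hw i.+1 lin).1.
Qed.

Lemma adapted_alive n : adapted z n (alive n).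
Proof.
have mDi i : (i <= n)%N -> adapted z n (z i @^-1` D).
  move=> lin; rewrite (_ : _ @^-1` _ = [set w | 1 <= \1_D (z i w) :> R]).
    apply: adapted_le; first exact: adapted_fun_cst.
    exact: adapted_fun_point.
  apply/seteqP; split=> w /=; rewrite indicE.
    by move=> Dw; rewrite mem_set.
  by case: (boolP (z i w \in D)) => [/set_mem//|_]; rewrite ler10.
rewrite (_ : alive n = z 0%N @^-1` D `&` [set w | forall i, (1 <= i <= n)%N ->
    (z i @^-1` D `&` [set w | `|fD (z i w)| <= C * `|fD (z i.-1 w)|]) w]).
  apply: adaptedI; first exact: mDi.
  apply: adapted_forall => i; apply: adapted_imply => /andP[i1 lin].
  apply: adaptedI; first exact: mDi.
  apply: adapted_le.
    apply: (adapted_fun_comp (h := fun x => `|x|)) => //.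
    exact: adapted_fun_point.
  apply: (adapted_fun_comp (h := fun x => C * `|x|)).
    apply: measurable_funM => //.
  by apply: adapted_fun_point => //; rewrite (leq_trans _ lin)// leq_pred.
have fDE x : D x -> fD x = f x by move=> Dx; rewrite /fD patchE mem_set.
(* Both points of a test lie in [D]: the earlier one is [z 0] or has passed its own test. So [f] and
   [fD] may be exchanged. *)
apply/seteqP; split=> w [/= Dz0 Hw]; split=> // i /[dup] i1n /Hw[Dzi].
  rewrite !fDE//; case: i Dzi i1n => // -[//|i] Dzi /= /ltnW i1n.
  by have [] := Hw i.+1 i1n.
rewrite /= !fDE//; case: i Dzi i1n => // -[//|i] Dzi /= /ltnW i1n.
by have [] := Hw i.+1 i1n.
Qed.


(** * Conditional law of the draws, coordinate by coordinate *)

Let X (j : 'I_d) n w : R := z n w ord0 j.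
Let U (j : 'I_d) n w : R := u n w ord0 j.

Lemma measurable_X j n : measurable_fun setT (X j n).
Proof. exact: (measurableT_comp (measurable_coord j) (mz n)). Qed.

Lemma measurable_U j n : measurable_fun setT (U j n).
Proof. exact: (measurableT_comp (measurable_coord j) (mu n)). Qed.

Lemma adapted_X j n i : (i <= n)%N -> adapted_fun z n (X j i).
Proof. exact: (adapted_fun_point z (measurable_coord j)). Qed.

Lemma draw_law_adapted i E (B : set 'rV[R]_d) : (0 < i)%N -> adapted z i E ->
  E `<=` alive i -> measurable B ->
  P (E `&` u i @^-1` B) =
    (\int[P]_(w in E) ball_law (draw_radius f k (z ^~ w) i) B)%E.
Proof.
move=> i0 [H mH EH] EA mB; have := draw_law z_process i0 mH mB.
by rewrite -EH /= (setIidl EA).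
Qed.

Lemma draw_sym i E j (B : set R) : (0 < i)%N -> adapted z i E ->
  E `<=` alive i -> measurable B ->
  P (E `&` U j i @^-1` B) = P (E `&` (fun w => - U j i w) @^-1` B).
Proof.
move=> i0 aE EA mB.
have mB' : measurable [set x : 'rV[R]_d | B (x ord0 j)].
  by rewrite -[X in measurable X]setTI; exact: measurable_coord.
rewrite [LHS](draw_law_adapted i0 aE EA mB').
have -> : E `&` (fun w => - U j i w) @^-1` B =
    E `&` u i @^-1` (-%R @^-1` [set x : 'rV[R]_d | B (x ord0 j)]).
  by congr (_ `&` _); apply/seteqP; split=> w /=; rewrite mxE.
rewrite draw_law_adapted//; last first.
  by rewrite -[X in measurable X]setTI; exact: measurable_rVN.
by apply: eq_integral => w _; rewrite ball_lawN.
Qed.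

(* By the symmetry of the draw, the cross term of the square integrates to 0. *)
Lemma draw_square_integral i E j y : (0 < i)%N -> adapted z i E ->
  E `<=` alive i -> adapted_fun z i y ->
  (\int[P]_(w in E) ((y w + U j i w) ^+ 2)%:E =
   \int[P]_(w in E) (y w ^+ 2)%:E + \int[P]_(w in E) (U j i w ^+ 2)%:E)%E.
Proof.
move=> i0 aE EA ay.
have mE := adapted_measurable mz aE; have my := adapted_fun_measurable mz ay.
have mUi := measurable_U j i.
have mS (w : T -> R) : measurable_fun setT w ->
    measurable_fun E (fun x => (w x ^+ 2)%:E).
  move=> mw; apply/measurable_EFinP; apply: measurable_funX.
  exact: measurable_funTS.
(* Half the square: the integral is two copies of that of [g], and changing the sign of the draw in
   one of them leaves [y ^+ 2 + U ^+ 2]. All integrands stay nonnegative, so the cross term is never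
   integrated alone. *)
pose g (p : R * R) : \bar R := (2^-1 * (p.1 + p.2) ^+ 2)%:E.
have g0 p : (0 <= g p)%E by rewrite lee_fin mulr_ge0// sqr_ge0.
have mg : measurable_fun setT g.
  apply/measurable_EFinP; apply: measurable_funM => //.
  by apply: measurable_funX; exact: measurable_funD.
have mgU v : measurable_fun setT v -> measurable_fun E (fun w => g (y w, v w)).
  move=> mv; apply: measurable_funTS.
  exact: (measurableT_comp mg (measurable_fun_pair my mv)).
have mNU : measurable_fun setT (fun w => - U j i w) by exact: measurableT_comp.
have gU : (\int[P]_(w in E) g (y w, U j i w) =
           \int[P]_(w in E) g (y w, (- U j i w)%R))%E.
  (* The symmetry is applied to [E] cut by an event on [y], which still depends on the past only. *)
  apply: eq_law_integral => // A B mA mB; rewrite !setIA.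
  apply: draw_sym => //.
    by apply: adaptedI => //; exact: adapted_preimage.
  by move=> w [/EA].
transitivity (\int[P]_(w in E) g (y w, U j i w) +
              \int[P]_(w in E) g (y w, U j i w))%E.
  rewrite -ge0_integralD//; try exact: mgU.
  by apply: eq_integral => w _; rewrite -EFinD /g/=; congr EFin; field.
rewrite [X in (_ + X)%E]gU -!ge0_integralD//; try exact: mgU; try exact: mS;
  try by move=> *; rewrite lee_fin sqr_ge0.
by apply: eq_integral => w _; rewrite -!EFinD /g/=; congr EFin; field.
Qed.

Lemma draw_outside i j (a : R) : (0 < i)%N -> 0 <= a ->
  (forall w, alive i w -> draw_radius f k (z ^~ w) i <= a) ->
  P (alive i `&` [set w | a < `|U j i w|]) = 0%E.
Proof.
move=> i0 a0 ra.
have mB : measurable [set x : 'rV[R]_d | a < `|x ord0 j|].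
  apply: measurable_ltset => //; apply: measurableT_comp => //.
  exact: measurable_coord.
rewrite [LHS](draw_law_adapted i0 (adapted_alive i) _ mB)//.
apply: integral0_eq => w wA; exact: ball_law_outside (ra w wA).
Qed.

(** Given the past, the draw stays in the cube of half-side [a] with probability at most 1/2;
    otherwise some coordinate exceeds [a], and a union bound over the coordinates applies. *)
Lemma draw_spread i E (a : R) : (0 < d)%N -> (0 < i)%N -> 0 < a ->
  adapted z i E -> E `<=` alive i ->
  (forall w, E w -> 2 * d%:R * a <= draw_radius f k (z ^~ w) i) ->
  (P E <= 2%:E * \sum_(j < d) P (alive i `&` [set w | (a < `|U j i w|)%R]))%E.
Proof.
move=> d0 i0 a0 aE EA rE; have mE := adapted_measurable mz aE.
pose K := [set x : 'rV[R]_d | forall j, `|x ord0 j| <= a].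
have mK : measurable K.
  apply: measurable_forall_ord => j; apply: measurable_leset => //.
  by apply: measurableT_comp => //; exact: measurable_coord.
have mL j : measurable (alive i `&` [set w | a < `|U j i w|]).
  apply: measurableI; first exact: adapted_measurable (adapted_alive i).
  apply: measurable_ltset => //; apply: measurableT_comp => //.
  exact: measurable_U.
have muK : measurable (u i @^-1` K).
  by rewrite -[X in measurable X]setTI; exact: mu.
have PEK : (P (E `&` u i @^-1` K) <= (2^-1)%:E * P E)%E.
  rewrite draw_law_adapted// -integral_cst//.
  apply: ge0_le_integral_nonmeasurable => w Ew; first exact: ball_law_ge0.
  exact/ball_law_cube/rE.
have PEC : (P (E `\` u i @^-1` K) <=
    \sum_(j < d) P (alive i `&` [set w | (a < `|U j i w|)%R]))%E.
  apply: (@le_trans _ _ (P (\big[setU/set0]_(j < d)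
      (alive i `&` [set w | (a < `|U j i w|)%R])))).
    apply: le_measure; rewrite ?inE//.
    - exact: measurableD.
    - by apply: bigsetU_measurable => j _; exact: mL.
    move=> w [Ew /existsNP[j /negP]]; rewrite -ltNge => aj.
    rewrite -bigcup_seq; exists j => /=; first by rewrite mem_index_enum.
    by split => //; exact: EA.
  set S := \big[setU/set0]_(j < d) _; set s := (\sum_(j < d) _)%E.
  suff : measurable S /\ (P S <= s)%E by case.
  rewrite /S /s {S s}; elim/big_rec2: _ => [|j s A _ [mA PA]].
    by rewrite measure0.
  split; first exact: measurableU.
  by apply: le_trans (measureU2 _ _ _) _ => //; rewrite leeD.
have PE_fin : P E \is a fin_num by exact: fin_num_measure.
(* [P E] is finite, so half of it can be absorbed on the left. *)
have : (P E <= (2^-1)%:E * P E +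
    \sum_(j < d) P (alive i `&` [set w | (a < `|U j i w|)%R]))%E.
  by rewrite {1}(measureDI P mE muK) addeC leeD.
set S := (\sum_(j < d) _)%E.
have : (0 <= S)%E by apply: sume_ge0.
case: S => [s| |]//; last by move=> _ _; rewrite mulry gtr0_sg// mul1e leey.
rewrite -(fineK PE_fin) -!EFinM -EFinD !lee_fin => _; lra.
Qed.

Lemma step_coord j i w : (0 < i)%N -> alive i w ->
  X j i.+1 w = X j i w + U j i w.
Proof.
by move=> i0 wA; rewrite /X (step_eq z_process i0 wA) mxE.
Qed.

Let measurable_sqr E (y : T -> R) : measurable_fun setT y ->
  measurable_fun E (fun w => (y w ^+ 2)%:E).
Proof.
move=> my; apply/measurable_EFinP; apply: measurable_funX.
exact: measurable_funTS.
Qed.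

Let sqr_ge0E (y : T -> R) w : (0 <= (y w ^+ 2)%:E)%E.
Proof. by rewrite lee_fin sqr_ge0. Qed.

Let malive n : measurable (alive n).
Proof. exact: adapted_measurable (adapted_alive n). Qed.

(** * Summability of the second moments of the draws *)

Variables M rho : R.
Hypotheses (M0 : 0 <= M) (rho0 : 0 <= rho).
Hypothesis D_le : forall x j, D x -> `|x ord0 j| <= M.
Hypothesis radius_le : forall i w, (0 < i)%N -> alive i w ->
  draw_radius f k (z ^~ w) i <= rho.

(* The draws start at rank 1: [u 0] is an arbitrary random variable, whose
   second moment may be infinite. *)
Definition coord_energy j i : \bar R :=
  if i is 0%N then 0%E else (\int[P]_(w in alive i) (U j i w ^+ 2)%:E)%E.

Lemma coord_energyE j i : (0 < i)%N ->
  coord_energy j i = (\int[P]_(w in alive i) (U j i w ^+ 2)%:E)%E.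
Proof. by case: i. Qed.

Lemma coord_energy_ge0 j i : (0 <= coord_energy j i)%E.
Proof. by case: i => // i; apply: integral_ge0. Qed.

(* A point drawn just before the run stops may lie outside [D], but only within
   distance [rho] of it. *)
Lemma stopped_square_integral j i : (0 < i)%N ->
  (\int[P]_(w in alive i `\` alive i.+1) (X j i.+1 w ^+ 2)%:E <=
   ((M + rho) ^+ 2)%:E * P (alive i `\` alive i.+1))%E.
Proof.
move=> i0; set S := alive i `\` alive i.+1.
have mS : measurable S by exact: measurableD.
(* Null by [draw_outside]; off it, the last point of a stopped run has coordinate at most [M + rho]
   in absolute value. *)
pose N := alive i `&` [set w | rho < `|U j i w|].
have mN : measurable N.
  apply: measurableI => //; apply: measurable_ltset => //.
  by apply: measurableT_comp => //; exact: measurable_U.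
rewrite -integral_cst//.
apply: ae_ge0_le_integral => //.
- exact: (measurable_sqr (measurable_X j i.+1)).
- by move=> w _; rewrite lee_fin sqr_ge0.
exists N; split=> //.
  by apply: draw_outside => // w wA; exact: radius_le.
move=> w /= /not_implyP[[wA _] Xw]; split=> //=.
rewrite ltNge; apply/negP => Uw.
apply: Xw; rewrite lee_fin step_coord// -real_normK ?num_real//.
rewrite lerXn2r ?nnegrE ?addr_ge0//.
apply: le_trans (ler_normD _ _) _; apply: lerD => //.
exact/D_le/(alive_point (leqnn i) wA).
Qed.

Lemma alive_square_integral_le j n :
  (\int[P]_(w in alive n) (X j n w ^+ 2)%:E <= (M ^+ 2)%:E)%E.
Proof.
apply: (@le_trans _ _ (\int[P]_(w in alive n) (cst (M ^+ 2)%:E) w)%E).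
  apply: ge0_le_integral => //.
  - exact: (measurable_sqr (measurable_X j n)).
  - move=> w wA; rewrite lee_fin -real_normK ?num_real//.
    rewrite lerXn2r ?nnegrE//.
    exact/D_le/(alive_point (leqnn n) wA).
rewrite integral_cst// -[leRHS]mule1; apply: lee_wpmul2l.
  by rewrite lee_fin sqr_ge0.
exact: probability_le1.
Qed.

(** The events of stopping at successive ranks are disjoint; the term [P (alive N.+1)] makes the
    induction telescope. *)
Lemma sum_stopped_le1 N :
  (\sum_(1 <= i < N.+1) P (alive i `\` alive i.+1) + P (alive N.+1) <= 1)%E.
Proof.
elim: N => [|N IH]; first by rewrite big_nil add0e probability_le1.
rewrite big_nat_recr//= -addeA.
suff -> : (P (alive N.+1 `\` alive N.+2) + P (alive N.+2) = P (alive N.+1))%E.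
  exact: IH.
rewrite [RHS](measureDI P (malive N.+1) (malive N.+2)) (setIidr _)//.
exact: aliveS.
Qed.

(** The second moment over live runs gains the energy of each draw and loses only what stopping runs
    carry away, at most [(M + rho) ^+ 2] times their probability. It never exceeds [M ^+ 2], and
    these probabilities sum to at most 1. *)
Lemma sum_coord_energy_le j N :
  (\sum_(1 <= i < N.+1) coord_energy j i <= (M ^+ 2 + (M + rho) ^+ 2)%:E)%E.
Proof.
pose a n := (\int[P]_(w in alive n) (X j n w ^+ 2)%:E)%E.
have a0 n : (0 <= a n)%E by apply: integral_ge0.
have aM n : (a n <= (M ^+ 2)%:E)%E by exact: alive_square_integral_le.
have step i : (0 < i)%N -> (a i + coord_energy j i <=
    a i.+1 + ((M + rho) ^+ 2)%:E * P (alive i `\` alive i.+1))%E.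
  move=> i0; rewrite coord_energyE// /a -draw_square_integral//; last 2 first.
  - exact: adapted_alive.
  - exact: adapted_X.
  rewrite (eq_integral (fun w => (X j i.+1 w ^+ 2)%:E)); last first.
    by move=> w /set_mem wA; rewrite step_coord.
  rewrite -[in leLHS](setDUK (@aliveS i)) ge0_integral_setU//.
  - by rewrite leeD// stopped_square_integral.
  - exact: measurableD.
  - exact: (measurable_sqr (measurable_X j i.+1)).
  - by apply/disj_set2P; rewrite setDIK.
clearbody a; have sum_step : (\sum_(1 <= i < N.+1) coord_energy j i <= a N.+1 +
    ((M + rho) ^+ 2)%:E * \sum_(1 <= i < N.+1) P (alive i `\` alive i.+1))%E.
  (* The initial moment [a 1] is put back on the left so that the steps telescope. *)
  apply: (@le_trans _ _ (a 1%N + \sum_(1 <= i < N.+1) coord_energy j i)%E).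
    by rewrite leeDr.
  elim: N => [|N IH]; first by rewrite !big_nil mule0.
  rewrite [in leLHS]big_nat_recr// [in leRHS]big_nat_recr// addeA.
  apply: (le_trans (leeD2r _ IH)).
  rewrite ge0_muleDr ?sume_ge0// addeAC.
  apply: (le_trans (leeD2r _ (step N.+1 isT))).
  by rewrite -!addeA leeD2l// addeC.
apply: (le_trans sum_step); rewrite EFinD leeD//.
rewrite -[leRHS]mule1 lee_wpmul2l ?lee_fin ?sqr_ge0//.
by apply: le_trans (sum_stopped_le1 N); rewrite leeDl.
Qed.

Definition energy i : \bar R := (\sum_(j < d) coord_energy j i)%E.

Lemma energy_ge0 i : (0 <= energy i)%E.
Proof. by apply: sume_ge0 => j _; exact: coord_energy_ge0. Qed.

Lemma coord_energy_le j i : (coord_energy j i <= energy i)%E.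
Proof.
rewrite /energy (bigD1 j)//= leeDl//.
by apply: sume_ge0 => l _; exact: coord_energy_ge0.
Qed.

Lemma energy_tail_cvg0 : (\sum_(N <= i <oo) energy i)%E @[N --> \oo] --> 0%E.
Proof.
apply: nneseries_tail_cvg => [|i _]; last exact: energy_ge0.
have W0 : 0 <= M ^+ 2 + (M + rho) ^+ 2 by rewrite addr_ge0// sqr_ge0.
apply: (@le_lt_trans _ _ (\sum_(j < d) (M ^+ 2 + (M + rho) ^+ 2)%:E)%E).
  apply: lime_le.
    by apply: is_cvg_nneseries => i _ _; exact: energy_ge0.
  near=> N.
  have -> : N = N.-1.+1 by rewrite prednK//; near: N; exact: nbhs_infty_gt.
  (* The term of rank 0 is 0 by convention, so the bounds on sums from rank 1 apply. *)
  rewrite big_ltn// {1}/energy big1 ?add0e//.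
  by rewrite exchange_big/=; apply: lee_sum => j _; exact: sum_coord_energy_le.
by rewrite sumEFin ltry.
Unshelve. all: by end_near. Qed.

(** * Kolmogorov's maximal inequality for one coordinate *)

Section oscillation.
Variables (j : 'I_d) (n : nat) (lam : R).
Hypotheses (n0 : (0 < n)%N) (lam0 : 0 < lam).

Let close m := alive m `&`
  [set w | forall l, (n <= l <= m)%N -> `|X j l w - X j n w| < lam].

(* [m.+1] is the first rank at which the coordinate is at distance at least
   [lam] from its value at rank [n]. *)
Definition escape m := close m `&`
  (alive m.+1 `&` [set w | lam <= `|X j m.+1 w - X j n w|]).

Let adapted_close m : (n <= m)%N -> adapted z m (close m).
Proof.
move=> nm; apply: adaptedI; first exact: adapted_alive.
apply: adapted_forall => l; apply: adapted_imply => /andP[_ lm].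
apply: adapted_lt; last exact: adapted_fun_cst.
apply: (adapted_fun_comp (h := fun x => `|x|)) => //.
by apply: adapted_funB; exact: adapted_X.
Qed.

Let mclose m : (n <= m)%N -> measurable (close m).
Proof. by move=> nm; exact: adapted_measurable (adapted_close nm). Qed.

Let mdist m : measurable_fun setT (fun w => X j m w - X j n w).
Proof. by apply: measurable_funB; exact: measurable_X. Qed.

Lemma measurable_escape m : (n <= m)%N -> measurable (escape m).
Proof.
move=> nm; apply: measurableI; first exact: mclose.
apply: measurableI => //; apply: measurable_leset => //.
by apply: measurableT_comp => //; exact: mdist.
Qed.

(* One step of Kolmogorov's maximal inequality for the coordinate stopped when
   it escapes. *)
Let close_step m : (n <= m)%N ->
  ((lam ^+ 2)%:E * P (escape m) +
   \int[P]_(w in close m.+1) ((X j m.+1 w - X j n w) ^+ 2)%:E <=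
   \int[P]_(w in close m) ((X j m w - X j n w) ^+ 2)%:E + energy m)%E.
Proof.
move=> nm; have m0 : (0 < m)%N by exact: leq_trans n0 nm.
have closeA : close m `<=` alive m by move=> w [].
apply: (@le_trans _ _
    (\int[P]_(w in close m) ((X j m w - X j n w) ^+ 2)%:E +
     \int[P]_(w in close m) (U j m w ^+ 2)%:E)%E); last first.
  rewrite leeD2l// (le_trans _ (coord_energy_le j m))// coord_energyE//.
  apply: ge0_subset_integral => //; first exact: mclose.
  exact: (measurable_sqr (measurable_U j m)).
(* The increment since rank [n] is known at rank [m], so the next draw adds its second moment
   without a cross term. *)
rewrite -draw_square_integral//; last 2 first.
- exact: adapted_close.
- by apply: adapted_funB; exact: adapted_X.
rewrite [leRHS](eq_integral (fun w => ((X j m.+1 w - X j n w) ^+ 2)%:E));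
  last first.
  move=> w /set_mem[wA _]; rewrite step_coord//.
  by congr EFin; ring.
have disj : [disjoint escape m & close m.+1].
  apply/disj_set2P/seteqP; split=> // w [[_ [_ /= Xw]] [_ /(_ m.+1)]].
  by rewrite leqnn leqW//= => /(_ isT); rewrite ltNge Xw.
(* From [close m], a run escapes, stays close or stops; runs that stop are dropped. On an escape the
   squared increment is at least [lam ^+ 2]. *)
apply: (@le_trans _ _ (\int[P]_(w in escape m `|` close m.+1)
    ((X j m.+1 w - X j n w) ^+ 2)%:E)%E).
  rewrite ge0_integral_setU//.
  - rewrite leeD2r// -integral_cst//; last exact: measurable_escape.
    apply: ge0_le_integral => //.
    + exact: measurable_escape.
    + by move=> w _; rewrite lee_fin sqr_ge0.
    + exact: (measurable_sqr (mdist m.+1)).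
    move=> w [_ [_ /= Xw]]; rewrite lee_fin -[leRHS]real_normK ?num_real//.
    by rewrite lerXn2r ?nnegrE ?(ltW lam0).
  - exact: measurable_escape.
  - by apply: mclose; exact: leqW.
  - exact: (measurable_sqr (mdist m.+1)).
  - by move=> w _; rewrite lee_fin sqr_ge0.
apply: ge0_subset_integral => //.
- by apply: measurableU; [exact: measurable_escape|apply: mclose; exact: leqW].
- exact: mclose.
- exact: (measurable_sqr (mdist m.+1)).
- by move=> w _; rewrite lee_fin sqr_ge0.
move=> w [[]//|[wA Xw]]; split; first exact: aliveS.
by move=> l /andP[nl lm]; apply: Xw; rewrite nl leqW.
Qed.

(** Telescopes [close_step], starting from a zero increment at rank [n]. *)
Let sum_escape_le N : ((lam ^+ 2)%:E * \sum_(n <= m < n + N) P (escape m) +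
    \int[P]_(w in close (n + N)) ((X j (n + N) w - X j n w) ^+ 2)%:E <=
    \sum_(n <= m < n + N) energy m)%E.
Proof.
elim: N => [|N IH].
  rewrite addn0 !big_geq// mule0 add0e integral0_eq// => w _.
  by rewrite subrr expr0n.
rewrite addnS big_nat_recr ?leq_addr// [leRHS]big_nat_recr ?leq_addr//.
rewrite ge0_muleDr ?sume_ge0// -addeA.
apply: (le_trans (leeD2l _ (close_step (leq_addr N n)))).
by rewrite addeA leeD2r.
Qed.

Lemma escape_le :
  ((lam ^+ 2)%:E * P (\bigcup_m escape (n + m)) <=
   \sum_(n <= m <oo) energy m)%E.
Proof.
have lam2 : 0 < lam ^+ 2 by rewrite exprn_gt0.
rewrite -lee_pdivlMl//.
apply: (@le_trans _ _ (\sum_(m <oo) P (escape (n + m)))%E).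
  apply: measure_sigma_subadditive => //.
    by move=> m; apply: measurable_escape; exact: leq_addr.
  by apply: bigcupT_measurable => m; apply: measurable_escape; exact: leq_addr.
apply: lime_le; first exact: is_cvg_nneseries.
near=> N; rewrite lee_pdivlMl//.
apply: (@le_trans _ _ (\sum_(n <= m < n + N) energy m)%E).
  apply: le_trans (sum_escape_le N).
  have -> : (\sum_(n <= m < n + N) P (escape m) =
             \sum_(0 <= m < N) P (escape (n + m)))%E.
    rewrite -{1}[n]add0n big_addn addKn.
    by apply: eq_bigr => m _; rewrite addnC.
  by rewrite leeDl// integral_ge0// => w _; rewrite lee_fin sqr_ge0.
by apply: nneseries_lim_ge => i _ _; exact: energy_ge0.
Unshelve. all: by end_near. Qed.

End oscillation.

(** * Almost sure Cauchy property and small values of [f] *)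

Lemma energy_tail_null (S : set T) (c : R) : 0 < c -> measurable S ->
  (forall n, (0 < n)%N -> c%:E * P S <= \sum_(n <= i <oo) energy i)%E ->
  P S = 0%E.
Proof.
move=> c0 mS cS; have : (c%:E * P S <= 0)%E.
  apply: (cvge_to_ge energy_tail_cvg0).
  by exists 1%N => // n; exact: cS.
by rewrite pmule_rle0 ?lte_fin// => PS; apply/eqP; rewrite eq_le PS measure_ge0.
Qed.

(** An infinite run violating the conclusion escapes after every rank, and by [escape_le] the
    probability of escaping after rank [n] is at most the energy tail divided by [lam ^+ 2]. *)
Lemma ae_coord_cauchy j lam : 0 < lam ->
  {ae P, forall w, infinite_seq D f C (z ^~ w) ->
    exists n, forall m, (n <= m)%N -> `|X j m w - X j n w| < lam}.
Proof.
(* The shift to [n.+1] keeps to positive ranks, where the draws start. *)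
move=> lam0; pose N := \bigcap_n \bigcup_m escape j n.+1 lam (n.+1 + m).
have mU n : measurable (\bigcup_m escape j n.+1 lam (n.+1 + m)).
  apply: bigcupT_measurable => m.
  by apply: measurable_escape => //; exact: leq_addr.
have mN : measurable N by exact: bigcapT_measurable.
exists N; split=> //.
  apply: (@energy_tail_null _ (lam ^+ 2)) => //; first by rewrite exprn_gt0.
  case=> // n _; apply: le_trans (escape_le j (isT : (0 < n.+1)%N) lam0).
  rewrite lee_wpmul2l ?lee_fin ?sqr_ge0// le_measure ?inE// => w.
  exact.
move=> w /= /not_implyP[[Dw Hw] osc].
move=> n _; apply: contrapT => esc; apply: osc; exists n.+1 => m.
have wA i : alive i w by split=> // l /andP[l0 _]; exact: Hw.
elim/ltn_ind: m => m IH nm; rewrite ltNge; apply/negP => Xm.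
have [m_eq|nm'] := eqVneq m n.+1.
  by move: Xm; rewrite m_eq subrr normr0 leNgt lam0.
(* By strong induction [m] is the first rank at distance at least [lam]; the escape leading to it is
   indexed by [m.-1]. *)
apply: esc; exists (m.-1 - n.+1)%N => //.
have nm1 : (n < m.-1)%N.
  rewrite -ltnS prednK; last exact: leq_trans nm.
  by rewrite ltn_neqAle nm andbT eq_sym.
have m_gt0 : (0 < m)%N by exact: leq_trans nm.
rewrite subnKC//; split; [split=> // l /andP[nl lm]|split=> //=].
  by apply: IH => //; rewrite -(prednK m_gt0) ltnS.
by rewrite prednK.
Qed.

Lemma coord_chebyshev j i (a : R) : (0 < i)%N -> 0 <= a ->
  ((a ^+ 2)%:E * P (alive i `&` [set w | (a < `|U j i w|)%R]) <=
   coord_energy j i)%E.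
Proof.
move=> i0 a0; set S := alive i `&` _.
have mS : measurable S.
  apply: measurableI => //; apply: measurable_ltset => //.
  by apply: measurableT_comp => //; exact: measurable_U.
rewrite coord_energyE// -integral_cst//.
apply: (@le_trans _ _ (\int[P]_(w in S) (U j i w ^+ 2)%:E)%E).
  apply: ge0_le_integral => //.
  - by move=> w _; rewrite lee_fin sqr_ge0.
  - exact: (measurable_sqr (measurable_U j i)).
  move=> w [_ /= /ltW aU]; rewrite lee_fin -[leRHS]real_normK ?num_real//.
  by rewrite lerXn2r ?nnegrE.
apply: ge0_subset_integral => //; last by move=> w [].
exact: (measurable_sqr (measurable_U j i)).
Qed.

Lemma ae_small_value (eta : R) : (0 < d)%N -> 0 < k -> 0 < eta ->
  {ae P, forall w, infinite_seq D f C (z ^~ w) ->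
    exists i, `|f (z i w)| < eta}.
Proof.
move=> d0 k0 eta0; pose E i := alive i `&` [set w | eta <= `|fD (z i w)|].
have fDE i w : alive i w -> fD (z i w) = f (z i w).
  by move=> wA; rewrite /fD patchE mem_set//; exact: alive_point (leqnn i) w wA.
have aE i : adapted z i (E i).
  apply: adaptedI; first exact: adapted_alive.
  apply: adapted_le; first exact: adapted_fun_cst.
  apply: (adapted_fun_comp (h := fun x => `|x|)) => //.
  exact: adapted_fun_point.
have d_gt0 : 0 < d%:R :> R by rewrite ltr0n.
(* Makes [2 * d%:R * a] equal to [k * eta], a lower bound of the radius on [E i]. *)
pose a := k * eta / (2 * d%:R).
have a0 : 0 < a by rewrite divr_gt0 ?mulr_gt0.
have mE i : measurable (E i) by exact: adapted_measurable (aE i).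
exists (\bigcap_i E i.+1); split.
- by apply: bigcapT_measurable => i; exact: mE.
(* The division by 2 cancels the factor 2 of [draw_spread], leaving [a ^+ 2] for Chebyshev's
   inequality. *)
- apply: (@energy_tail_null _ (a ^+ 2 / 2)).
  + by rewrite divr_gt0// exprn_gt0.
  + by apply: bigcapT_measurable => i; exact: mE.
  case=> // i _; apply: (@le_trans _ _ (energy i.+1)); last first.
    have -> : energy i.+1 = (\sum_(i.+1 <= l < i.+2) energy l)%E.
      by rewrite big_nat1.
    by apply: nneseries_lim_ge => l _ _; exact: energy_ge0.
  apply: (@le_trans _ _ ((a ^+ 2 / 2)%:E * P (E i.+1))%E).
    rewrite lee_wpmul2l ?lee_fin ?divr_ge0 ?sqr_ge0// le_measure ?inE//.
      by apply: bigcapT_measurable => l; exact: mE.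
    by move=> w; exact.
  apply: (@le_trans _ _ ((a ^+ 2 / 2)%:E * (2%:E *
      \sum_(j < d) P (alive i.+1 `&` [set w | (a < `|U j i.+1 w|)%R])))%E).
    rewrite lee_wpmul2l ?lee_fin ?divr_ge0 ?sqr_ge0//.
    apply: draw_spread => //; first by move=> w [].
    move=> w [wA] /=; rewrite fDE// => eta_le.
    rewrite /a mulrC divfK ?gt_eqF ?mulr_gt0// /draw_radius.
    apply: ler_wpDl; first by rewrite divr_ge0// sqrtr_ge0.
    by rewrite ler_wpM2l// ltW.
  rewrite muleA -EFinM divfK// ge0_sume_distrr//.
  by apply: lee_sum => j _; apply: coord_chebyshev => //; exact: ltW.
move=> w /= /not_implyP[[Dw Hw] small] i _.
have wA : alive i.+1 w by split=> // l /andP[l0 _]; exact: Hw.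
split=> //=; rewrite fDE// leNgt; apply/negP => fz; apply: small.
by exists i.+1.
Qed.

End process.

(** * From the almost sure estimates to the limit *)

Lemma normr_coord_le (R : realType) (d : nat) (x : 'rV[R]_d) j :
  `|x ord0 j| <= `|x|.
Proof.
rewrite [leRHS]/Num.norm/= mx_normrE; apply/bigmax_geP; right => /=.
by exists (ord0, j).
Qed.

Lemma bounded_set_le (R : realType) (V : normedModType R) (A : set V) :
  bounded_set A -> exists2 M : R, 0 <= M & forall x, A x -> `|x| <= M.
Proof.
move=> [M [_ AM]]; exists (`|M| + 1); first by rewrite addr_ge0.
by apply: AM; rewrite ltr_pwDr// ler_norm.
Qed.

Unset Implicit Arguments.
Set Strict Implicit.
Set Printing Implicit Defensive.

Theorem theorem1 (R : realType) (d : nat) (D : set 'rV[R]_d)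
    (f : 'rV[R]_d -> R) (k C : R)
    (D_bounded : bounded_set D) (D_closed : closed D)
    (f_continuous : {within D, continuous f})
    (S_nonempty : [set x | D x /\ f x = 0] !=set0)
    (k_gt0 : 0 < k) (C_ge : 2^-1 <= C) (C_le : C <= 1)
    (dT : measure_display) (T : measurableType dT) (P : probability T R)
    (z u : nat -> T -> 'rV[R]_d)
    (z_process : search_process D f k C P z u) :
  {ae P, forall w, infinite_seq D f C (z ^~ w) ->
    exists2 l, [set x | D x /\ f x = 0] l & z ^~ w @ \oo --> l}.
Proof.
(* In dimension 0 the only point is the given zero of [f]; the volume comparison of [ball_law_cube]
   asks for positive [d]. *)
have [d0|d_gt0] := posnP d.
  have [s [Ds fs]] := S_nonempty; apply/aeW => w _; exists s => //.
  have zs n : z n w = s.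
    by apply/rowP => j; exfalso; move: j; rewrite d0 => -[].
  have -> : z ^~ w = cst s by exact/funext.
  exact: cvg_cst.
have mD : measurable D.
  rewrite -[X in measurable X]setCK; apply: measurableC.
  by apply: measurable_rV_open; exact: closed_openC.
have mf := measurable_within_continuous mD f_continuous.
have [M M0 DM] := bounded_set_le D_bounded.
have D_compact : compact D by exact: bounded_closed_compact.
have [F F0 fF] := bounded_set_le
  (compact_bounded (continuous_compact f_continuous D_compact)).
(* Coordinates of two points of [D] differ by at most [2 * M], so their distance is at most
   [d%:R * (2 * M)]; [F] bounds [f] on the compact [D]. *)
pose rho := d%:R * (2 * M) / 2 + k * F.
have rho0 : 0 <= rho by rewrite addr_ge0 ?divr_ge0 ?mulr_ge0// ltW.
have D_le x j : D x -> `|x ord0 j| <= M.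
  by move=> Dx; rewrite (le_trans (normr_coord_le x j))// DM.
have radius_le i w : (0 < i)%N -> running D f C (z ^~ w) i ->
    draw_radius f k (z ^~ w) i <= rho.
  move=> i0 wA; have Dz := alive_point _ wA.
  apply: lerD; last first.
    rewrite ler_wpM2l ?(ltW k_gt0)// fF//.
    by exists (z i w) => //; exact: Dz.
  rewrite ler_wpM2r// enorm_le_cube ?mulr_ge0// => j; rewrite !mxE.
  rewrite (le_trans (ler_normB _ _))// mulr_natl mulr2n lerD// D_le//.
    exact: Dz.
  by apply: Dz; exact: leq_pred.
(* Thresholds [q.+1%:R^-1] are countably many, so one null set serves for all of them. *)
have cauchy_z : {ae P, forall w, forall (q : nat) (j : 'I_d),
    infinite_seq D f C (z ^~ w) ->
    exists n, forall m, (n <= m)%N ->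
      `|z m w ord0 j - z n w ord0 j| < q.+1%:R^-1}.
  apply: ae_foralln => q; apply: filter_forall => j.
  exact: (ae_coord_cauchy mD mf z_process M0 rho0 D_le radius_le).
have small_f : {ae P, forall w, forall q : nat, infinite_seq D f C (z ^~ w) ->
    exists i, `|f (z i w)| < q.+1%:R^-1}.
  apply: ae_foralln => q.
  exact: (ae_small_value mD mf z_process M0 rho0 D_le radius_le).
apply: filterS2 cauchy_z small_f => w zC zf winf.
have Dz n : D (z n w).
  by have [Dz0 Hz] := winf; case: n => // n; exact: (Hz n.+1 isT).1.
have z_cauchy : cauchy (z ^~ w @ \oo).
  apply: cauchy_exP => e e0.
  have /ltr_add_invr[q] := e0; rewrite add0r => qe.
  have /choice[n nP] : forall j, exists n, forall m, (n <= m)%N ->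
      `|z m w ord0 j - z n w ord0 j| < q.+1%:R^-1.
    by move=> j; exact: zC.
  (* The centre takes each coordinate at its own rank [n j]; beyond the largest of these ranks all
     coordinates are close to it. *)
  exists (\row_j z (n j) w ord0 j), (\max_j n j) => // m /= nm.
  split=> // i j; rewrite [i]ord1 mxE /ball/= distrC; apply: lt_trans qe.
  by apply: nP; apply: leq_trans nm; exact: leq_bigmax.
have z_cvg : z ^~ w @ \oo --> lim (z ^~ w @ \oo) by exact: cauchy_cvg.
set l := lim _ in z_cvg.
have Dl : D l by apply: (closed_cvg _ D_closed _ _ z_cvg); exact: nearW.
exists l => //; split=> //.
have fz_cvg : f (z n w) @[n --> \oo] --> f l.
  have /subspace_continuousP/(_ l Dl) fl := f_continuous.
  move=> A /fl lA; have : \forall n \near \oo, D (z n w) -> A (f (z n w)).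
    exact: z_cvg _ lA.
  by apply: filterS => n; apply; exact: Dz.
(* As [C <= 1], the values [|f (z n w)|] are nonincreasing along an infinite run. *)
have fz_le q n m : `|f (z n w)| < q.+1%:R^-1 -> (n <= m)%N ->
    `|f (z m w)| < q.+1%:R^-1.
  move=> fn /subnKC <-; elim: (m - n)%N => [|i IH]; first by rewrite addn0.
  have [_ /(_ (n + i).+1 isT)[_]] := winf.
  rewrite addnS => /le_lt_trans; apply; apply: le_lt_trans IH.
  by rewrite ler_piMl.
(* Otherwise some [q.+1%:R^-1] is below [|f l|], while [fz_le] keeps all late values, hence their
   limit, at or below it. *)
apply/eqP; rewrite -normr_le0 leNgt; apply/negP => /ltr_add_invr[q].
rewrite add0r ltNge => /negP; apply.
have [n fn] := zf q winf.
apply: (cvgr_to_le (cvg_norm fz_cvg)).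
by exists n => // m /=; move=> /(fz_le _ _ _ fn) /ltW.
Qed.
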